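(* Let $Q$ be a weakly multiplicative open quantal frame. If $Q$ is embeddable then it is multiplicative.
   Context: A quantale is a sup-lattice with an associative multiplication preserving joins in each variable (not necessarily unital). An involutive quantal frame $Q$ is a quantale with a join-preserving involution ($a^{**}=a$, $(ab)^*=b^*a^*$) whose underlying lattice is a frame; $1$ is its top. $R(Q)=\{a\in Q:a1\le a\}$, a subframe. $Q$ is open if, with $\upsilon(a)=\bigvee_{xy^*\le a}x\wedge y$, for all $a,b,c\in Q$: $b(a1\wedge c)=(b\wedge1a^* )c$; $\upsilon(a)\in R(Q)$; $\bigvee_{xx^*x\le a}x=a$; $(a1\wedge b)c=a1\wedge bc$. $Q$ is an $R(Q)$-$R(Q)$-bimodule via $z\cdot a=a\wedge z$, $a\cdot z=a\wedge z^*$; $Q\otimes_{R(Q)}Q$ is the tensor product of sup-lattices. For $Q$ open the multiplication factors through the reduced multiplication $\mu_0:Q\otimes_{R(Q)}Q\to Q$, $a\otimes b\mapsto ab$. $Q$ is multiplicative if the right adjoint $(\mu_0)_*$ preserves joins. Regard frames also as locales; for a locale map $f$, $f^*$ is its inverse image, while for $a\in Q$, $a^*$ is the involute. $d,r:Q\to R(Q)$, $i:Q\to Q$ are the locale maps with $d^*(z)=z$, $r^*(z)=z^*$, $i^*(a)=a^*$. For $U\in R(Q)$, $\widetilde U$ is the locale with frame $\{z\in R(Q):z\le U\}$, and $k_U:\widetilde U\to R(Q)$ has $k_U^*(z)=z\wedge U$. A local bisection is a pair $\sigma=(U,s)=(U_\sigma,s_\sigma)$, $U\in R(Q)$, $s:\widetilde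 U\to Q$ a locale map with $d\circ s=k_U$ and $r\circ s$ an open regular monomorphism. Then $r\circ s=k_V\circ\alpha$ with $\alpha:\widetilde U\to\widetilde V$ an isomorphism; $\sigma^{-1}=(V,i\circ s\circ\alpha^{-1})$. $\Gamma(Q)$ is the set of local bisections. Put $\sigma\cdot a=\bigvee_{x^*y\le a}s_\sigma^*(x)\wedge y$ and $f_{\sigma,\tau}(a)=\bigvee_{xy\le a}s_\sigma^*(x\wedge s_\tau^*(y)^* )$. If $f_{\sigma,\tau}$ preserves joins, the product $\sigma\tau$ is the local bisection with $U_{\sigma\tau}=s_\sigma^*(U_\tau^* )$, $s_{\sigma\tau}^*=f_{\sigma,\tau}$. $Q$ is weakly multiplicative if $\upsilon$ preserves joins, every $\sigma\cdot(-)$ preserves joins (then all products exist), and the product on $\Gamma(Q)$ is associative. Then $\Gamma(Q)$ is a complete infinitely distributive inverse semigroup whose natural order is restriction. $\widehat Q=\mathcal L^\vee(\Gamma(Q))$ is the quantale completion of $\Gamma(Q)$: the set of downwards closed subsets of $\Gamma(Q)$ closed under joins of compatible families ($\sigma,\tau$ compatible: $\sigma\tau^{-1}$, $\sigma^{-1}\tau$ idempotent), ordered by inclusion, with product $AB$ the least such subset containing all $\sigma\tau$ ($\sigma\in A,\tau\in B$) and involution $A^*=\{\sigma^{-1}:\sigma\in A\}$. It is an inverse quantal frame. Write $\widehat\sigma=\{\tau:\tau\le\sigma\}\in\widehat Q$, and let $j:Q\to\widehat Q$ be the frame homomorphism $j(a)=\{\sigma\in\Gamma(Q):s_\sigma^*(a)=U_\sigma\}$.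 $Q$ is weakly embeddable if $\widehat\sigma\,j(a)=j(\sigma\cdot a)$ for all $a\in Q$, $\sigma\in\Gamma(Q)$. Then $\widehat Q$ is an $R(Q)$-$R(Q)$-bimodule via $z\cdot A=j(z)\wedge A$, $A\cdot z=A\wedge j(z^* )$, and $j$ is a module homomorphism. $Q$ is embeddable if it is weakly embeddable and $j\otimes\mathrm{id}:Q\otimes_{R(Q)}Q\to\widehat Q\otimes_{R(Q)}Q$ is a monomorphism. *)

(* Defs.v *)
From HB Require Import structures.
From mathcomp Require Import all_boot all_order.
From mathcomp Require Import boolp classical_sets.

Set Implicit Arguments.
Unset Strict Implicit.
Unset Printing Implicit Defensive.

Import Order.Theory.
Local Open Scope classical_set_scope.
Local Open Scope group_scope.
Local Open Scope order_scope.

HB.mixin Record hasSup (d : Order.disp_t) T of Order.POrder d T := {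
  Sup : set T -> T;
  Sup_leP : forall (S : set T) (x : T),
    (Sup S <= x) <-> (forall y, S y -> y <= x)
}.

#[short(type="supLatticeType")]
HB.structure Definition SupLattice (d : Order.disp_t) :=
  { T of hasSup d T & Order.TBLattice d T }.

HB.factory Record POrder_isSupLattice (d : Order.disp_t) T
    of Order.POrder d T := {
  Sup : set T -> T;
  Sup_leP : forall (S : set T) (x : T),
    (Sup S <= x) <-> (forall y, S y -> y <= x)
}.

HB.builders Context d T of POrder_isSupLattice d T.

Let le_Sup (S : set T) x : S x -> x <= Sup S.
Proof. by move: x; apply/Sup_leP; exact: le_refl. Qed.

Let meet x y := Sup [set z | z <= x /\ z <= y].
Let join x y := Sup [set z | z = x \/ z = y].

Let meetP x y z : (x <= meet y z) = (x <= y) && (x <= z).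
Proof.
apply/idP/andP => [xyz|[xy xz]]; last exact: le_Sup.
by split; apply: le_trans xyz _; apply/Sup_leP => t -[].
Qed.

Let joinP x y z : (join x y <= z) = (x <= z) && (y <= z).
Proof.
apply/idP/andP => [xyz|[xz yz]]; last by apply/Sup_leP => t [->|->].
by split; apply: le_trans xyz; apply: le_Sup; [left|right].
Qed.

Let bot := Sup set0.
Let top := Sup setT.

Let bot_le x : bot <= x.
Proof. by apply/Sup_leP. Qed.

Let le_top x : x <= top.
Proof. exact: le_Sup. Qed.

HB.instance Definition _ :=
  Order.POrder_MeetJoin_isLattice.Build d T meetP joinP.
HB.instance Definition _ := Order.hasBottom.Build d T bot_le.
HB.instance Definition _ := Order.hasTop.Build d T le_top.
HB.instance Definition _ := hasSup.Build d T Sup_leP.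

HB.end.

HB.mixin Record isFrame (d : Order.disp_t) T of SupLattice d T := {
  meet_Sup : forall (a : T) (S : set T),
    a `&` Sup S = Sup [set a `&` b | b in S]
}.

#[short(type="frameType")]
HB.structure Definition Frame (d : Order.disp_t) :=
  { T of isFrame d T & SupLattice d T }.

HB.mixin Record isQuantale (d : Order.disp_t) T
    of SupLattice d T & Semigroup T := {
  mul_Supl : forall (S : set T) (b : T),
    (Sup S * b)%g = Sup [set (a * b)%g | a in S];
  mul_Supr : forall (a : T) (S : set T),
    (a * Sup S)%g = Sup [set (a * b)%g | b in S]
}.

#[short(type="quantaleType")]
HB.structure Definition Quantale (d : Order.disp_t) :=
  { T of isQuantale d T & SupLattice d T & Semigroup T }.

HB.mixin Record isInvolutive (d : Order.disp_t) T of Quantale d T := {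
  invol : T -> T;
  involK : involutive invol;
  involM : forall a b : T, invol (a * b)%g = (invol b * invol a)%g;
  invol_Sup : forall S : set T, invol (Sup S) = Sup (invol @` S)
}.

#[short(type="involutiveQuantaleType")]
HB.structure Definition InvolutiveQuantale (d : Order.disp_t) :=
  { T of isInvolutive d T & Quantale d T }.

#[short(type="involutiveQuantalFrameType")]
HB.structure Definition InvolutiveQuantalFrame (d : Order.disp_t) :=
  { T of InvolutiveQuantale d T & Frame d T }.

Notation "a ^*" := (invol a) : order_scope.
Notation "a * b" := (mul a b) : order_scope.

Section SupLatticeTheory.
Variables (d : Order.disp_t) (L : supLatticeType d).
Implicit Types (S : set L) (x y : L).

Lemma le_Sup S x : S x -> x <= Sup S.
Proof. by move: x; apply/Sup_leP. Qed.

Lemma eq_SupP S x : (forall y, (x <= y) <-> (forall z, S z -> z <= y)) ->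
  x = Sup S.
Proof.
move=> xP; apply: le_anti; apply/andP; split.
  by apply/xP => z; exact: le_Sup.
by apply/Sup_leP/xP.
Qed.

Lemma SupU2 x y : x `|` y = Sup [set z | z = x \/ z = y].
Proof.
apply: eq_SupP => z; rewrite leUx; split=> [/andP[xz yz] t [->|->] //|H].
by apply/andP; split; apply: H; [left|right].
Qed.

End SupLatticeTheory.

Definition preserves_Sup d d' (L : supLatticeType d) (M : supLatticeType d')
    (f : L -> M) : Prop :=
  forall S : set L, f (Sup S) = Sup (f @` S).

(* The right adjoint of f when f preserves joins. *)
Definition right_adjoint d d' (L : supLatticeType d) (M : supLatticeType d')
    (f : L -> M) (y : M) : L :=
  Sup [set x | f x <= y].

(* Monomorphism in the category of sup-lattices, for f preserving joins. *)
Definition monomorphism d d' (L : supLatticeType d) (M : supLatticeType d')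
    (f : L -> M) : Prop :=
  forall (e : Order.disp_t) (W : supLatticeType e) (g h : W -> L),
    preserves_Sup g -> preserves_Sup h -> f \o g =1 f \o h -> g =1 h.

Lemma preserves_Sup_le d d' (L : supLatticeType d) (M : supLatticeType d')
    (f : L -> M) : preserves_Sup f -> {homo f : x y / x <= y}.
Proof.
move=> fS x y; rewrite leEjoin => /eqP <-.
by rewrite SupU2 fS; apply: le_Sup; exists x => //; left.
Qed.

(* A locale map X -> Y is given by its inverse image, a frame homomorphism
   from Y to X. *)
Record locale_map d d' (X : frameType d) (Y : frameType d') := LocaleMap {
  inv_im : Y -> X;
  inv_im_Sup : preserves_Sup inv_im;
  inv_imI : {morph inv_im : a b / a `&` b};
  inv_imT : inv_im \top = \top
}.

Lemma locale_map_ext d d' (X : frameType d) (Y : frameType d')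
  (f g : locale_map X Y) : inv_im f =1 inv_im g -> f = g.
Proof.
case: f g => [f f1 f2 f3] [g g1 g2 g3] /= /funext fg.
by case: _ / fg in g1 g2 g3 *; congr LocaleMap; exact: Prop_irrelevance.
Qed.

Section LocaleComp.
Variables (d1 d2 d3 : Order.disp_t).
Variables (X : frameType d1) (Y : frameType d2) (Z : frameType d3).

Fact id_Sup : preserves_Sup (@id X).
Proof. by move=> S; rewrite image_id. Qed.

Definition locale_id : locale_map X X :=
  @LocaleMap _ _ X X id id_Sup (fun _ _ => erefl) erefl.

Variables (g : locale_map Y Z) (f : locale_map X Y).

Fact comp_Sup : preserves_Sup (inv_im f \o inv_im g).
Proof. by move=> S /=; rewrite !inv_im_Sup image_comp. Qed.

Fact compI : {morph inv_im f \o inv_im g : a b / a `&` b}.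
Proof. by move=> a b /=; rewrite !inv_imI. Qed.

Fact compT : (inv_im f \o inv_im g) \top = \top.
Proof. by rewrite /= !inv_imT. Qed.

Definition locale_comp : locale_map X Z := LocaleMap comp_Sup compI compT.

End LocaleComp.
Arguments locale_id {d1} X.

(* f is open when f^* has a left adjoint satisfying the Frobenius law. *)
Definition open_locale_map d d' (X : frameType d) (Y : frameType d')
    (f : locale_map X Y) : Prop :=
  exists2 f_ : X -> Y,
    forall x y, (f_ x <= y) = (x <= inv_im f y) &
    forall x y, f_ (x `&` inv_im f y) = f_ x `&` y.

Definition is_equalizer d d' e (X : frameType d) (Y : frameType d')
    (Z : frameType e) (f : locale_map X Y) (g h : locale_map Y Z) : Prop :=
  locale_comp g f = locale_comp h f /\
  forall (e' : Order.disp_t) (W : frameType e') (k : locale_map W Y),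
    locale_comp g k = locale_comp h k ->
    exists! l : locale_map W X, locale_comp f l = k.

Definition regular_mono d d' (X : frameType d) (Y : frameType d')
    (f : locale_map X Y) : Prop :=
  exists (e : Order.disp_t) (Z : frameType e) (g h : locale_map Y Z),
    is_equalizer f g h.

(* The top of the resulting frame need not be the top of L. *)
Record subframe_pred d (L : frameType d) := SubframePred {
  sf_pred : pred L;
  sf_Sup : forall S : set L, (forall x, S x -> sf_pred x) -> sf_pred (Sup S);
  sf_meet : forall x y, sf_pred x -> sf_pred y -> sf_pred (x `&` y)
}.

Record subframe d (L : frameType d) (P : subframe_pred L) := Subframe {
  subframe_val : L;
  _ : sf_pred P subframe_val
}.

Section SubframeInstances.
Variables (d : Order.disp_t) (L : frameType d) (P : subframe_pred L).
Notation T := (subframe P).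

HB.instance Definition _ := [isSub for @subframe_val d L P].
HB.instance Definition _ := [Choice of T by <:].

Let leT (x y : T) := val x <= val y.

Fact leT_refl : reflexive leT. Proof. by move=> x; exact: le_refl. Qed.
Fact leT_anti : antisymmetric leT.
Proof. by move=> x y xy; apply/val_inj/le_anti. Qed.
Fact leT_trans : transitive leT. Proof. by move=> y x z; exact: le_trans. Qed.

HB.instance Definition _ :=
  Order.Le_isPOrder.Build d T leT_refl leT_anti leT_trans.

Lemma le_subframeE (x y : T) : (x <= y) = (val x <= val y).
Proof. by []. Qed.

Fact subframe_Sup_closed (S : set T) : sf_pred P (Sup (val @` S)).
Proof. by apply: sf_Sup => _ [x _ <-]; exact: valP. Qed.

Definition subframe_Sup (S : set T) : T :=
  Subframe (subframe_Sup_closed S).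

Fact subframe_Sup_leP (S : set T) (x : T) :
  (subframe_Sup S <= x) <-> (forall y, S y -> y <= x).
Proof.
rewrite le_subframeE /=; split=> [/Sup_leP H y Sy|H].
  by rewrite le_subframeE; apply: H; exists y.
by apply/Sup_leP => _ [y Sy <-]; rewrite -le_subframeE; exact: H.
Qed.

HB.instance Definition _ := POrder_isSupLattice.Build d T subframe_Sup_leP.

Lemma val_Sup (S : set T) : val (Sup S) = Sup (val @` S).
Proof. by []. Qed.

Lemma val_meet (x y : T) : val (x `&` y) = val x `&` val y.
Proof.
have xyP := sf_meet (valP x) (valP y).
pose z : T := Subframe xyP.
suff -> : x `&` y = z by [].
apply: le_anti; apply/andP; split.
  rewrite [_ <= z]le_subframeE [val z]/= lexI.
  by apply/andP; split; [exact: (leIl x y)|exact: (leIr y x)].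
by rewrite lexI !le_subframeE leIl leIr.
Qed.

Fact subframe_meet_Sup (a : T) (S : set T) :
  a `&` Sup S = Sup [set a `&` b | b in S].
Proof.
apply: val_inj; rewrite val_meet !val_Sup meet_Sup !image_comp /=.
by congr Sup; apply: eq_imagel => x _; exact: esym (val_meet a x).
Qed.

HB.instance Definition _ := isFrame.Build d T subframe_meet_Sup.

End SubframeInstances.

Record closure_system (T : Type) := ClosureSystem {
  cs_pred : set (set T);
  cs_bigcap : forall F : set (set T), F `<=` cs_pred ->
    cs_pred (\bigcap_(A in F) A)
}.

Record closed_sets (T : Type) (C : closure_system T) := ClosedSet {
  closed_set_val : set T;
  _ : `[< cs_pred C closed_set_val >]
}.

Section ClosedSets.
Variables (T : Type) (C : closure_system T).
Notation CS := (closed_sets C).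

HB.instance Definition _ := [isSub for @closed_set_val T C].
HB.instance Definition _ := [Choice of CS by <:].

Let leCS (A B : CS) := val A <= val B.

Fact leCS_refl : reflexive leCS. Proof. by move=> x; exact: le_refl. Qed.
Fact leCS_anti : antisymmetric leCS.
Proof. by move=> x y xy; apply/val_inj/le_anti. Qed.
Fact leCS_trans : transitive leCS.
Proof. by move=> y x z; exact: le_trans. Qed.

HB.instance Definition _ :=
  Order.Le_isPOrder.Build set_display CS leCS_refl leCS_anti leCS_trans.

Lemma le_closed_setsP (A B : CS) : (A <= B) <-> (val A `<=` val B).
Proof. by split=> /subsetPset. Qed.

Fact closed_hull_subproof (X : set T) :
  `[< cs_pred C (\bigcap_(A in [set A | cs_pred C A /\ X `<=` A]) A) >].
Proof. by apply/asboolP/cs_bigcap => A []. Qed.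

Lemma closed_setP (A : CS) : cs_pred C (val A).
Proof. by case: A => A /= /asboolP. Qed.

Definition closed_hull (X : set T) : CS := ClosedSet (closed_hull_subproof X).

Lemma closed_hull_leP (X : set T) (A : CS) :
  (closed_hull X <= A) <-> (X `<=` val A).
Proof.
split=> [/le_closed_setsP H x Xx|XA].
  by apply: H => B [_]; apply.
apply/le_closed_setsP => x; apply; split => //.
exact: closed_setP.
Qed.

Lemma closed_hull_id (X : set T) : cs_pred C X -> val (closed_hull X) = X.
Proof.
move=> XC; apply/seteqP; split=> x; last by move=> Xx A [_]; apply.
by apply; split.
Qed.

Fact closed_sets_Sup_leP (F : set CS) (A : CS) :
  (closed_hull (\bigcup_(B in F) val B) <= A) <-> (forall B, F B -> B <= A).
Proof.
split=> [/closed_hull_leP H B FB|H].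
  by apply/le_closed_setsP => x Bx; apply: H; exists B.
apply/closed_hull_leP => x [B FB Bx].
by move/le_closed_setsP: (H B FB); apply.
Qed.

HB.instance Definition _ :=
  POrder_isSupLattice.Build set_display CS closed_sets_Sup_leP.

Lemma val_closed_setsI (A B : CS) : val (A `&` B) = (val A `&` val B)%classic.
Proof.
have AB : `[< cs_pred C (val A `&` val B)%classic >].
  apply/asboolP.
  have -> : (val A `&` val B =
      \bigcap_(D in [set D | D = val A \/ D = val B]) D)%classic.
    apply/seteqP; split=> x; first by case=> Ax Bx D /= [->|->].
    by move=> H; split; apply: H; [left|right].
  by apply: cs_bigcap => D /= [->|->]; exact: closed_setP.
apply/seteqP; split=> [x ABx|].
  by split; move: x ABx; apply/le_closed_setsP; [exact: leIl|exact: leIr].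
have : (ClosedSet AB : CS) <= A `&` B.
  by rewrite lexI; apply/andP; split; apply/le_closed_setsP => x /= [].
by move/le_closed_setsP.
Qed.

End ClosedSets.

(* M (x)_R N, presented by generators m (x) n and the relations saying that
   (x) preserves joins in each variable and (m . z) (x) n = m (x) (z . n).
   An element is represented by the set of all pairs (m, n) such that
   m (x) n lies below it. *)
Section Tensor.
Variables (d d' : Order.disp_t) (M : supLatticeType d) (N : supLatticeType d').
Variables (R : Type) (ract : M -> R -> M) (lact : R -> N -> N).

Definition tensor_saturated (I : set (M * N)%type) : Prop :=
  [/\ forall (S : set M) n, I (Sup S, n) <-> (forall m, S m -> I (m, n)),
      forall m (S : set N), I (m, Sup S) <-> (forall n, S n -> I (m, n)) &
      forall m z n, I (ract m z, n) <-> I (m, lact z n)].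

Fact tensor_saturated_bigcap (F : set (set (M * N)%type)) :
  F `<=` tensor_saturated -> tensor_saturated (\bigcap_(I in F) I).
Proof.
move=> FS; split.
- move=> S n; split=> [H m Sm I FI|H I FI].
    by have [/(_ S n)[h _] _ _] := FS I FI; apply: h Sm; exact: H.
  by have [/(_ S n)[_ h] _ _] := FS I FI; apply: h => m Sm; exact: H.
- move=> m S; split=> [H n Sn I FI|H I FI].
    by have [_ /(_ m S)[h _] _] := FS I FI; apply: h Sn; exact: H.
  by have [_ /(_ m S)[_ h] _] := FS I FI; apply: h => n Sn; exact: H.
- move=> m z n; split=> H I FI.
    by have [_ _ /(_ m z n)[h _]] := FS I FI; apply: h; exact: H.
  by have [_ _ /(_ m z n)[_ h]] := FS I FI; apply: h; exact: H.
Qed.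

Definition tensor_system := ClosureSystem tensor_saturated_bigcap.

Notation tensor := (closed_sets tensor_system).

Definition pure_tensor (m : M) (n : N) : tensor :=
  closed_hull tensor_system [set (m, n)].

Definition balanced_bimorphism e (L : supLatticeType e) (g : M -> N -> L) :=
  [/\ forall n, preserves_Sup (g^~ n), forall m, preserves_Sup (g m) &
      forall m z n, g (ract m z) n = g m (lact z n)].

(* The join-preserving map induced by a balanced bimorphism g; see
   tensor_liftE, tensor_lift_Sup and tensor_lift_unique. *)
Definition tensor_lift e (L : supLatticeType e) (g : M -> N -> L)
    (t : tensor) : L :=
  Sup [set g p.1 p.2 | p in (val t : set (M * N)%type)].

End Tensor.

Notation tensor ract lact := (closed_sets (tensor_system ract lact)).

Section TensorUniversal.
Variables (d d' : Order.disp_t) (M : supLatticeType d) (N : supLatticeType d').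
Variables (R : Type) (ract : M -> R -> M) (lact : R -> N -> N).
Notation MN := (tensor ract lact).
Notation pure := (pure_tensor ract lact).

Lemma pure_tensor_leP m n (t : MN) : (pure m n <= t) <-> val t (m, n).
Proof.
split=> [/closed_hull_leP|H]; first exact.
by apply/closed_hull_leP => _ ->.
Qed.

Lemma tensor_Sup_pure (t : MN) :
  t = Sup [set pure p.1 p.2 | p in (val t : set (M * N)%type)].
Proof.
apply: eq_SupP => u; split=> [/le_closed_setsP tu _ [[m n] tmn <-]|H].
  exact/pure_tensor_leP/tu.
apply/le_closed_setsP => -[m n] tmn.
by apply/pure_tensor_leP/H; exists (m, n).
Qed.

Lemma pure_balanced : balanced_bimorphism ract lact pure.
Proof.
have sat (t : MN) : tensor_saturated ract lact (val t) by exact: (closed_setP t).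
split.
- move=> n S; apply: eq_SupP => t; have [h _ _] := sat t.
  split=> [/pure_tensor_leP/h H _ [m Sm <-]|H].
    by apply/pure_tensor_leP/H.
  by apply/pure_tensor_leP/h => m Sm; apply/pure_tensor_leP/H; exists m.
- move=> m S; apply: eq_SupP => t; have [_ h _] := sat t.
  split=> [/pure_tensor_leP/h H _ [n Sn <-]|H].
    by apply/pure_tensor_leP/H.
  by apply/pure_tensor_leP/h => n Sn; apply/pure_tensor_leP/H; exists n.
- move=> m z n; apply: le_anti; apply/andP; split; apply/pure_tensor_leP.
    by have [_ _ h] := sat (pure m (lact z n)); exact/h/pure_tensor_leP.
  by have [_ _ h] := sat (pure (ract m z) n); exact/h/pure_tensor_leP.
Qed.

Variables (e : Order.disp_t) (L : supLatticeType e) (g : M -> N -> L).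
Hypothesis gP : balanced_bimorphism ract lact g.
Notation lift := (@tensor_lift _ _ M N R ract lact e L g).

Let below (x : L) : set (M * N)%type := [set p | g p.1 p.2 <= x].

Let below_sat x : tensor_saturated ract lact (below x).
Proof.
case: gP => gl gr gb; split=> [S n|m S|m z n]; rewrite /below /=.
- rewrite gl; split=> [/Sup_leP H m Sm|H]; first by apply: H; exists m.
  by apply/Sup_leP => _ [m Sm <-]; exact: H.
- rewrite gr; split=> [/Sup_leP H n Sn|H]; first by apply: H; exists n.
  by apply/Sup_leP => _ [n Sn <-]; exact: H.
- by rewrite gb.
Qed.

Let belowT x : MN := closed_hull (tensor_system ract lact) (below x).

Let belowTE x : val (belowT x) = below x.
Proof. exact: (closed_hull_id (C := tensor_system ract lact) (below_sat x)). Qed.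

Let lift_leP (t : MN) x : (lift t <= x) <-> (t <= belowT x).
Proof.
rewrite le_closed_setsP belowTE; split=> [/Sup_leP H p tp|H].
  by apply: H; exists p.
by apply/Sup_leP => _ [p tp <-]; exact: H.
Qed.

Lemma tensor_lift_Sup : preserves_Sup lift.
Proof.
move=> F; apply: eq_SupP => x; rewrite lift_leP Sup_leP; split.
  by move=> H _ [t Ft <-]; exact/lift_leP/H.
by move=> H t Ft; apply/lift_leP/H; exists t.
Qed.

Lemma tensor_liftE m n : lift (pure m n) = g m n.
Proof.
apply: le_anti; apply/andP; split.
  by apply/lift_leP/pure_tensor_leP; rewrite belowTE /below /=.
by apply: le_Sup; exists (m, n) => //; exact/pure_tensor_leP.
Qed.

Lemma tensor_lift_unique (h : MN -> L) : preserves_Sup h ->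
  (forall m n, h (pure m n) = g m n) -> h =1 lift.
Proof.
move=> hS hE t; rewrite {1}(tensor_Sup_pure t) hS /tensor_lift image_comp.
by congr Sup; apply: eq_imagel => p _ /=.
Qed.

End TensorUniversal.

Section QuantalFrame.
Variables (d : Order.disp_t) (Q : involutiveQuantalFrameType d).
Implicit Types (a b c x y : Q).

Fact mul_le2 a b x y : a <= b -> x <= y -> a * x <= b * y.
Proof.
move=> ab xy; apply: (@le_trans _ _ (b * x)).
  have := @preserves_Sup_le _ _ Q Q (fun a => a * x) (fun S => mul_Supl S x).
  exact.
exact: (preserves_Sup_le (@mul_Supr _ Q b)).
Qed.

Fact rsided_Sup (S : set Q) :
  (forall z, S z -> z * \top <= z) -> Sup S * \top <= Sup S.
Proof.
move=> H; rewrite mul_Supl; apply/Sup_leP => _ [z Sz <-].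
by apply: le_trans (H z Sz) _; exact: le_Sup.
Qed.

Fact rsided_meet x y :
  x * \top <= x -> y * \top <= y -> (x `&` y) * \top <= x `&` y.
Proof.
move=> xR yR; rewrite lexI (le_trans (mul_le2 (leIl x y) (le_refl _)) xR) /=.
exact: le_trans (mul_le2 (leIr y x) (le_refl _)) yR.
Qed.

Definition rsided_pred : subframe_pred Q :=
  @SubframePred _ Q (fun z => z * \top <= z) rsided_Sup rsided_meet.

(* R(Q) *)
Notation rsided := (subframe rsided_pred).

Definition upsilon a : Q := Sup [set t | exists x y, x * y^* <= a /\ t = x `&` y].

Definition open_quantal_frame : Prop :=
  [/\ forall a b c, b * ((a * \top) `&` c) = (b `&` (\top * a^*)) * c,
      forall a, upsilon a * \top <= upsilon a,
      forall a, Sup [set x | x * x^* * x <= a] = a &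
      forall a b c, ((a * \top) `&` b) * c = (a * \top) `&` (b * c)].

Definition lact (z : rsided) a : Q := a `&` val z.
Definition ract a (z : rsided) : Q := a `&` (val z)^*.

(* The reduced multiplication; see mu0_balanced for its well-definedness. *)
Definition mu0 : tensor ract lact -> Q := tensor_lift mul.

Definition multiplicative : Prop := preserves_Sup (right_adjoint mu0).

Lemma invol_le a b : (a^* <= b^*) = (a <= b).
Proof.
apply/idP/idP; last exact: (preserves_Sup_le (@invol_Sup _ Q)).
by move/(preserves_Sup_le (@invol_Sup _ Q)); rewrite !involK.
Qed.

Lemma invol_meet : {morph (@invol _ Q) : a b / a `&` b}.
Proof.
move=> a b; apply: le_anti; apply/andP; split.
  by rewrite lexI !invol_le leIl leIr.
rewrite -[leLHS]involK invol_le lexI.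
by rewrite -[X in _ <= X]involK invol_le leIl -[X in _ <= X]involK invol_le leIr.
Qed.

Lemma invol_top : (\top : Q)^* = \top.
Proof. by apply: le_anti; rewrite lex1 -[leLHS]involK invol_le lex1. Qed.

Lemma open_rsidedE (z : rsided) : open_quantal_frame -> val z * \top = val z.
Proof.
case=> _ _ h _; apply: le_anti; apply/andP; split; first exact: (valP z).
rewrite -[leRHS]h; apply: le_Sup => /=.
by rewrite -mulgA; apply: mul_le2 => //; exact: lex1.
Qed.

Lemma mu0_balanced : open_quantal_frame ->
  balanced_bimorphism ract lact (@mul Q).
Proof.
move=> Qo; split=> [b S|a S|a z b]; [exact: mul_Supl|exact: mul_Supr|].
case: (Qo) => h _ _ _; rewrite /ract /lact (meetC b).
have := h (val z) a b; rewrite open_rsidedE // => ->.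
by rewrite -{1}[\top]invol_top -involM open_rsidedE.
Qed.

End QuantalFrame.

Notation rsided Q := (subframe (rsided_pred Q)).

Definition principal_pred d (L : frameType d) (u : L) : subframe_pred L.
Proof.
apply: (@SubframePred _ L (fun z => z <= u)).
  by move=> S H; apply/Sup_leP.
by move=> x y xu _; exact: le_trans (leIl _ _) xu.
Defined.

(* The open sublocale of L determined by u. *)
Notation downset u := (subframe (principal_pred u)).

Section Bisections.
Variables (d : Order.disp_t) (Q : involutiveQuantalFrameType d).
Implicit Types (a b c x y : Q).

Section StructureMaps.

Fact val_rsided_Sup : preserves_Sup (val : rsided Q -> Q).
Proof. by []. Qed.

Fact val_rsidedT : val (\top : rsided Q) = \top.
Proof.
have TR : (\top : Q) * \top <= \top by exact: lex1.
pose t : rsided Q := Subframe (P := rsided_pred Q) TR.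
have : t <= \top by exact: lex1.
by rewrite le_subframeE => tT; apply: le_anti; rewrite lex1.
Qed.

Definition dom_map : locale_map Q (rsided Q) :=
  LocaleMap val_rsided_Sup (@val_meet _ _ _) val_rsidedT.

Fact inv_Sup : preserves_Sup (@invol _ Q).
Proof. exact: invol_Sup. Qed.

Definition inv_map : locale_map Q Q :=
  LocaleMap inv_Sup (@invol_meet _ Q) (@invol_top _ Q).

(* r^*(z) = z^* *)
Definition cod_map : locale_map Q (rsided Q) := locale_comp dom_map inv_map.

Variable U : rsided Q.

Fact restr_subproof (z : rsided Q) : z `&` U <= U.
Proof. exact: leIr. Qed.

Definition restr (z : rsided Q) : downset U :=
  Subframe (P := principal_pred U) (restr_subproof z).

Fact restr_Sup : preserves_Sup restr.
Proof.
move=> S; apply: val_inj; rewrite val_Sup image_comp /= meetC meet_Sup.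
by congr Sup; apply: eq_imagel => z _; rewrite meetC.
Qed.

Fact restr_meet : {morph restr : a b / a `&` b}.
Proof.
by move=> a b; apply: val_inj; rewrite val_meet /= meetACA meetxx.
Qed.

Fact restrT : restr \top = \top.
Proof.
apply: le_anti; rewrite lex1 /=.
have h : val (\top : downset U) <= U by exact: (valP (\top : downset U)).
by rewrite le_subframeE /= meet1x.
Qed.

Definition incl_map : locale_map (downset U) (rsided Q) :=
  LocaleMap restr_Sup restr_meet restrT.

End StructureMaps.

Record bisection := Bisection {
  bdom : rsided Q;
  bsec : locale_map (downset bdom) Q;
  _ : locale_comp dom_map bsec = incl_map bdom;
  _ : open_locale_map (locale_comp cod_map bsec);
  _ : regular_mono (locale_comp cod_map bsec)
}.

HB.instance Definition _ := gen_eqMixin bisection.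
HB.instance Definition _ := gen_choiceMixin bisection.
Implicit Types s t : bisection.

(* s^*(a), as an element of Q *)
Definition bpull s a : Q := val (val (inv_im (bsec s) a)).

Definition is_binv s t : Prop :=
  exists (al : locale_map (downset (bdom s)) (downset (bdom t)))
         (be : locale_map (downset (bdom t)) (downset (bdom s))),
    [/\ locale_comp be al = locale_id _,
        locale_comp al be = locale_id _,
        locale_comp cod_map (bsec s) = locale_comp (incl_map (bdom t)) al &
        bsec t = locale_comp inv_map (locale_comp (bsec s) be)].

(* s^{-1} is the unique bisection satisfying is_binv; the default value s is
   never used, since every local bisection has an inverse. *)
Definition binv s : bisection := xget s [set t | is_binv s t].

Definition bact s a : Q :=
  Sup [set u | exists x y, x^* * y <= a /\ u = bpull s x `&` y].

Definition bprod_pull s t a : downset (bdom s) :=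
  Sup [set u | exists x y,
    x * y <= a /\ u = inv_im (bsec s) (x `&` (bpull t y)^*)].

Definition is_bmul s t u : Prop :=
  bdom u = val (inv_im (bsec s) (val (bdom t))^*) /\
  forall a, val (inv_im (bsec u) a) = val (bprod_pull s t a).

(* The product st is the unique bisection satisfying is_bmul, when it exists;
   it does whenever bprod_pull s t preserves joins, and then the default
   value s is not used. *)
Definition bmul s t : bisection := xget s [set u | is_bmul s t u].

HB.instance Definition _ := hasMul.Build bisection bmul.

Definition weakly_multiplicative : Prop :=
  [/\ preserves_Sup (@upsilon _ Q),
      forall s, preserves_Sup (bact s) &
      associative bmul].

Definition bidempotent s : Prop := s * s = s.

(* The algebraic definition; on local bisections it amounts to restriction. *)
Definition ble s t : Prop := exists2 e, bidempotent e & s = e * t.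

Definition bcompatible s t : Prop :=
  bidempotent (s * binv t) /\ bidempotent (binv s * t).

Definition is_bjoin (X : set bisection) t : Prop :=
  (forall s, X s -> ble s t) /\
  forall t', (forall s, X s -> ble s t') -> ble t t'.

Definition bclosed (A : set bisection) : Prop :=
  (forall s t, ble s t -> A t -> A s) /\
  forall (X : set bisection) t, X `<=` A ->
    (forall s s', X s -> X s' -> bcompatible s s') -> is_bjoin X t -> A t.

Fact bclosed_bigcap (F : set (set bisection)) :
  F `<=` bclosed -> bclosed (\bigcap_(A in F) A).
Proof.
move=> FC; split=> [s t st At A FA|X t XA Xc Xt A FA].
  by have [h _] := FC A FA; apply: h st _; exact: At.
by have [_ h] := FC A FA; apply: h Xc Xt => s Xs; exact: XA.
Qed.

Definition completion_system := ClosureSystem bclosed_bigcap.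

Notation completion := (closed_sets completion_system).
Notation hull := (closed_hull completion_system).

Definition completion_mul (A B : completion) : completion :=
  hull [set r | exists s t, [/\ val A s, val B t & r = s * t]].

(* The two sets below are bclosed when Q is open and weakly multiplicative,
   in which case taking the hull has no effect (closed_hull_id). *)
Definition completion_principal s : completion := hull [set t | ble t s].

Definition jmap a : completion := hull [set s | bpull s a = val (bdom s)].

Definition weakly_embeddable : Prop :=
  forall s a, completion_mul (completion_principal s) (jmap a) = jmap (bact s a).

Definition completion_ract (A : completion) (z : rsided Q) : completion :=
  A `&` jmap (val z)^*.

(* j (x) id, the join-preserving map such that a (x) b |-> j(a) (x) b *)
Definition j_tensor_id :
    tensor (@ract _ Q) (@lact _ Q) -> tensor completion_ract (@lact _ Q) :=
  tensor_lift (fun a b => pure_tensor completion_ract (@lact _ Q) (jmap a) b).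

Definition embeddable : Prop :=
  weakly_embeddable /\ monomorphism j_tensor_id.

End Bisections.

(* Main.v *)
Require Import Defs.
From HB Require Import structures.
From mathcomp Require Import all_boot all_order.
From mathcomp Require Import boolp classical_sets.

(** The right adjoint of the reduced multiplication sends [a] to the join of
    the tensors [x (x) y] with [x * y <= a].  A monomorphism of sup-lattices
    is injective, so joins may be compared after applying [j (x) id], and the
    theorem comes down to the formula

      (j (x) id) ((mu0)_* a) = \/_s  <s> (x) (s^-1 . a)

    where [s] ranges over all local bisections and [<s>] is the least element
    of the completion containing [s].  Each term on the right preserves joins
    in [a], because the action of a local bisection does
    ([j_tensor_id_right_adjoint]).

    For [<=]: [j x] is the join of the [<s>] with [s^*(x)] equal to the domain
    of [s].  For such [s] and [x * y <= a], the part of [y] lying over the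
    codomain [V] of [s] is below [s^-1 . a], and nothing is lost by cutting
    [y] down to [V], since [<s>] is fixed by the right action of [V].
    For [>=]: a generator of [s^-1 . a] is [W /\ y] with [x * y <= a] and [W]
    the image under [s] of [s^*(x)]; moving [W] across the tensor turns [<s>]
    into its restriction to [s^*(x)], which is below [j x].

    Two facts about local bisections have to be established for this.  They
    have inverses ([inverse_exists]); the existence of an inverse rests on the
    description of an open regular monomorphism into a locale as, up to
    isomorphism, the inclusion of an open sublocale.  Moreover the elements of
    the completion generated by bisections [s] satisfying
    [s^*(a) <= s^*(b)] consist of such bisections ([bclosed_pull_le]).  The
    order and the joins that define the completion are given algebraically, so
    this requires that the natural order is restriction ([bleP]): all
    products exist ([mul_exists]), the units [U /\ upsilon] are bisections
    ([unit_exists]), and associativity forces every idempotent to be one of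
    them ([idempotent_unit]). *)

Set Implicit Arguments.
Unset Strict Implicit.
Unset Printing Implicit Defensive.

Import Order.Theory.
Local Open Scope classical_set_scope.
Local Open Scope order_scope.

(** * Open regular monomorphisms of locales *)

(** The image [I] of [f^*] is a subframe of [X], so [f] factors as [X -> I -> Y]
    and the second factor equalizes the same pair of maps as [f].  The induced
    map [I -> X] splits [X -> I], whose inverse image is the inclusion of [I];
    hence [I] is all of [X]. *)
Lemma regular_mono_surj d d' (X : frameType d) (Y : frameType d')
    (f : locale_map X Y) (x : X) :
  regular_mono f -> exists y, inv_im f y = x.
Proof.
case=> e [Z [g [h [gf univ]]]].
have imS (S : set X) : (forall x, S x -> `[< exists y, inv_im f y = x >]) ->
    `[< exists y, inv_im f y = Sup S >].
  move=> Sim; apply/asboolP; exists (Sup [set y | S (inv_im f y)]).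
  rewrite inv_im_Sup; congr Sup; apply/seteqP; split=> [_ [y Sy <-] //|u Su].
  by have /asboolP[y yu] := Sim u Su; exists y => //=; rewrite yu.
have imI (u v : X) : `[< exists y, inv_im f y = u >] ->
    `[< exists y, inv_im f y = v >] -> `[< exists y, inv_im f y = u `&` v >].
  move=> /asboolP[y <-] /asboolP[y' <-]; apply/asboolP.
  by exists (y `&` y'); rewrite inv_imI.
pose P := SubframePred imS imI.
have imP y : sf_pred P (inv_im f y) by apply/asboolP; exists y.
have valT : val (\top : subframe P) = \top.
  have TP : sf_pred P \top by rewrite -(inv_imT f).
  have : (Subframe TP : subframe P) <= \top by exact: lex1.
  by rewrite le_subframeE /= => h'; apply: le_anti; rewrite lex1.
have kS : preserves_Sup (fun y => Subframe (imP y) : subframe P).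
  by move=> S; apply: val_inj; rewrite val_Sup image_comp /= inv_im_Sup.
have kI : {morph (fun y => Subframe (imP y) : subframe P) : a b / a `&` b}.
  by move=> a b; apply: val_inj; rewrite val_meet /= inv_imI.
have kT : Subframe (imP \top) = \top :> subframe P.
  by apply: val_inj; rewrite valT /= inv_imT.
pose k : locale_map (subframe P) Y := LocaleMap kS kI kT.
pose q : locale_map X (subframe P) :=
  @LocaleMap _ _ X (subframe P) val (fun S => erefl) (@val_meet _ _ P) valT.
have gk : locale_comp g k = locale_comp h k.
  apply: locale_map_ext => z; apply: val_inj => /=.
  exact: (congr1 (fun m => inv_im m z) gf).
have [l [fl _]] := univ _ _ k gk.
have [l' [_ l'_uniq]] := univ _ _ f gf.
have id_lq : locale_id X = locale_comp l q.
  rewrite -[LHS](l'_uniq); first last.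
    by apply: locale_map_ext.
  apply: l'_uniq; apply: locale_map_ext => y /=.
  by have /= -> := congr1 (fun m => inv_im m y) fl.
have := congr1 (fun m => inv_im m x) id_lq => /= ->.
exact/asboolP/(valP (inv_im l x)).
Qed.

(** The Sierpinski locale: its opens are the empty set, the open point [true]
    and the whole space, so that maps into it classify open sublocales. *)
Fact sierpinski_bigcap (F : set (set bool)) :
  F `<=` [set A | A false -> A true] ->
  (\bigcap_(A in F) A) false -> (\bigcap_(A in F) A) true.
Proof. by move=> FC Ff A FA; apply: FC => //; apply: Ff. Qed.

Definition sierpinski_system := ClosureSystem sierpinski_bigcap.
Definition sierpinski := closed_sets sierpinski_system.

HB.instance Definition _ := SupLattice.on sierpinski.

Lemma sierpinski_val_Sup (S : set sierpinski) b :
  (val (Sup S) : set bool) b <-> exists2 A, S A & (val A : set bool) b.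
Proof.
split=> [|[A SA Ab]]; last by have /le_closed_setsP := le_Sup SA; apply.
have unionP : cs_pred sierpinski_system
    (\bigcup_(A in S) (val A : set bool)).
  by move=> [A SA Af]; exists A => //; apply: (closed_setP A).
rewrite [val _](closed_hull_id unionP).
by case=> A SA Ab; exists A.
Qed.

Fact sierpinski_meet_Sup (A : sierpinski) (S : set sierpinski) :
  A `&` Sup S = Sup [set A `&` B | B in S].
Proof.
apply: val_inj; apply/seteqP; split=> b.
  rewrite val_closed_setsI => -[Ab /sierpinski_val_Sup[B SB Bb]].
  by apply/sierpinski_val_Sup; exists (A `&` B); [exists B|rewrite val_closed_setsI].
move/sierpinski_val_Sup => [_ [B SB <-]]; rewrite !val_closed_setsI => -[Ab Bb].
by split => //; apply/sierpinski_val_Sup; exists B.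
Qed.

HB.instance Definition _ :=
  isFrame.Build set_display sierpinski sierpinski_meet_Sup.

Fact open_point_subproof : `[< cs_pred sierpinski_system [set true] >].
Proof. exact/asboolP. Qed.

Definition open_point : sierpinski := ClosedSet open_point_subproof.

Section Classify.
Variables (d : Order.disp_t) (Y : frameType d) (v : Y).

(** The inverse image of the map to the Sierpinski locale under which the open
    point pulls back to [v]. *)
Definition classify_pull (A : sierpinski) : Y :=
  if `[< (val A : set bool) false >] then \top
  else if `[< (val A : set bool) true >] then v else \bot.

Lemma classify_pull_leP A x :
  (classify_pull A <= x) <->
  ((val A : set bool) false -> \top <= x) /\ ((val A : set bool) true -> v <= x).
Proof.
rewrite /classify_pull; have := closed_setP A => /= AP.
case: asboolP => [Af|Af].
  split=> [Tx|[Tx _]]; last exact: Tx.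
  by split=> // _; apply: le_trans Tx; exact: lex1.
case: asboolP => At; last by split=> // _; exact: le0x.
by split=> [vx|[_ vx]]; [split | exact: vx].
Qed.

Fact classify_Sup : preserves_Sup classify_pull.
Proof.
move=> S; apply: eq_SupP => x; split.
  move/classify_pull_leP => [Tx vx] _ [A SA <-]; apply/classify_pull_leP.
  by split=> H; [apply: Tx|apply: vx]; apply/sierpinski_val_Sup; exists A.
move=> H; apply/classify_pull_leP.
by split=> /sierpinski_val_Sup[A SA Ab];
  have /classify_pull_leP[h1 h2] := H _ (ex_intro2 _ _ A SA erefl); auto.
Qed.

Fact classify_meet : {morph classify_pull : A B / A `&` B}.
Proof.
move=> A B; rewrite /classify_pull val_closed_setsI !asbool_and.
have := closed_setP A; have := closed_setP B => /= BP AP.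
case: (asboolP ((val A : set bool) false)) => Af;
case: (asboolP ((val B : set bool) false)) => Bf;
case: (asboolP ((val A : set bool) true)) => At;
case: (asboolP ((val B : set bool) true)) => Bt //=;
  rewrite ?meet1x ?meetx1 ?meet0x ?meetx0 ?meetxx //; by [case: (At (AP Af))|case: (Bt (BP Bf))].
Qed.

Fact classifyT : classify_pull \top = \top.
Proof.
rewrite /classify_pull asboolT //.
have TP : `[< cs_pred sierpinski_system setT >] by apply/asboolP.
have /le_closed_setsP H : (ClosedSet TP : sierpinski) <= \top by exact: lex1.
exact: H.
Qed.

Definition classify : locale_map Y sierpinski :=
  LocaleMap classify_Sup classify_meet classifyT.

End Classify.

(** With [V] the image of the top, [f^*] and its left adjoint [f_] restrict to
    inverse bijections between [X] and the elements below [V].  So [f] is the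
    equalizer of the maps to the Sierpinski locale that classify [V] and the
    top: a map [k] equalizes them exactly when [k^* V] is the top. *)
Lemma open_surj_regular_mono d d' (X : frameType d) (Y : frameType d')
    (f : locale_map X Y) :
  open_locale_map f -> (forall x, exists y, inv_im f y = x) -> regular_mono f.
Proof.
case=> f_ adj frob surj; pose v := f_ \top.
have f_K x : inv_im f (f_ x) = x.
  have [y <-] := surj x; apply: le_anti; apply/andP; split; last by rewrite -adj.
  by apply: (preserves_Sup_le (@inv_im_Sup _ _ _ _ f)); rewrite adj.
have fK y : f_ (inv_im f y) = v `&` y by rewrite -[inv_im f y]meet1x frob.
have f_le : {homo f_ : x y / x <= y} by move=> x y xy; rewrite adj f_K.
have f_Sup : preserves_Sup f_.
  move=> S; apply: eq_SupP => y; rewrite adj; split=> [/Sup_leP H _ [x Sx <-]|H].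
    by rewrite adj; exact: H.
  by apply/Sup_leP => x Sx; rewrite -adj; apply: H; exists x.
have f_I : {morph f_ : a b / a `&` b}.
  by move=> a b; rewrite -{1}(f_K b) frob.
exists _, sierpinski, (classify v), (classify \top); split.
  apply: locale_map_ext => A /=; rewrite /classify_pull.
  by case: asboolP => // _; case: asboolP => // _; rewrite f_K inv_imT.
move=> e' W k kv.
have kvT : inv_im k v = \top.
  have /= := congr1 (fun m => inv_im m open_point) kv.
  rewrite /classify_pull /=.
  by rewrite asboolF // asboolT // inv_imT.
have lS : preserves_Sup (inv_im k \o f_).
  by move=> S /=; rewrite f_Sup inv_im_Sup image_comp.
have lI : {morph inv_im k \o f_ : a b / a `&` b}.
  by move=> a b /=; rewrite f_I inv_imI.
exists (LocaleMap lS lI kvT); split.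
  by apply: locale_map_ext => y /=; rewrite fK inv_imI kvT meet1x.
move=> l fl; apply: locale_map_ext => x /=.
by rewrite -fl /= f_K.
Qed.

(** An element [u] is the value at the open point of a join-preserving map out
    of the opens of the Sierpinski locale, namely the one sending every
    nonempty open to [u]. *)
Lemma monomorphism_inj d d' (L : supLatticeType d) (M : supLatticeType d')
    (f : L -> M) : monomorphism f -> injective f.
Proof.
move=> mono x y xy.
pose point (u : L) (A : sierpinski) : L :=
  if `[< (val A : set bool) true >] then u else \bot.
have pointS u : preserves_Sup (point u).
  move=> S; apply: eq_SupP => z; rewrite /point; split.
    case: asboolP => [_ uz _ [A _ <-]|nS _ _ [A SA <-]].
      by case: asboolP => // _; exact: le0x.
    rewrite asboolF ?le0x // => At; apply: nS.
    by apply/sierpinski_val_Sup; exists A.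
  move=> H; case: asboolP => [/sierpinski_val_Sup[A SA At]|_]; last exact: le0x.
  by have := H (point u A) (ex_intro2 _ _ A SA erefl); rewrite /point asboolT.
have := mono _ _ _ _ (pointS x) (pointS y) _ open_point.
rewrite /point /= asboolT //; apply=> A /=.
by case: asboolP.
Qed.

(** * Local bisections as pairs of maps on right-sided elements *)

Section BisectionData.
Variables (d : Order.disp_t) (Q : involutiveQuantalFrameType d).
Implicit Types (a b c x y : Q) (U w z : rsided Q) (s t e : bisection Q).

Definition pull s a : rsided Q := val (inv_im (bsec s) a).

Lemma val_downset_top U : val (\top : downset U) = U.
Proof.
have topU : val (\top : downset U) <= U by exact: (valP (\top : downset U)).
apply: le_anti; rewrite topU /=.
have UU : U <= U by [].
have : (Subframe (P := principal_pred U) UU) <= \top by exact: lex1.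
by rewrite le_subframeE.
Qed.

Lemma pull_le s a : pull s a <= bdom s.
Proof. exact: (valP (inv_im (bsec s) a)). Qed.

Lemma pull_Sup s : preserves_Sup (pull s).
Proof. by move=> S; rewrite /pull inv_im_Sup val_Sup image_comp. Qed.

Lemma pullI s : {morph pull s : a b / a `&` b}.
Proof. by move=> a b; rewrite /pull inv_imI val_meet. Qed.

Lemma pullT s : pull s \top = bdom s.
Proof. by rewrite /pull inv_imT val_downset_top. Qed.

Lemma pull_mono s : {homo pull s : a b / a <= b}.
Proof. exact: preserves_Sup_le (@pull_Sup s). Qed.

Lemma pull_val s z : pull s (val z) = z `&` bdom s.
Proof.
case: s => U m ds os rs; rewrite /pull /=.
by have /= -> := congr1 (fun f => inv_im f z) ds.
Qed.

Lemma bisection_ext s t : bdom s = bdom t -> pull s =1 pull t -> s = t.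
Proof.
case: s t => U f ds os rs [V g dt ot rt] /= UV; subst V => fg.
have fgE : f = g by apply: locale_map_ext => a; apply: val_inj; exact: fg.
by subst g; congr Bisection; exact: Prop_irrelevance.
Qed.

(** [q] plays the role of the direct image of [r o s] along the target, with
    [q w] the image of [w /\ U]: it is left adjoint to [z |-> p z^*],
    satisfies the Frobenius law (so [r o s] is open), and has this map as a
    left inverse (so [r o s] is a regular monomorphism). *)
Definition bisection_push U (p : Q -> rsided Q) (q : rsided Q -> rsided Q) :=
  [/\ forall w z, (q w <= z) = (w `&` U <= p (val z)^*),
      forall w z, q (w `&` p (val z)^*) = q w `&` z &
      forall w, p (val (q w))^* = w `&` U].

Lemma push_exists s : exists q, bisection_push (bdom s) (pull s) q.
Proof.
case: s => U f ds os rs; rewrite /pull /=.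
case: (os) => f_ adj frob; pose q w := f_ (restr U w).
have leD (x y : downset U) : (x <= y) = (val x <= val y) by [].
have adjq w z : (q w <= z) = (w `&` U <= val (inv_im f (val z)^*)).
  by rewrite /q adj leD.
exists q; split=> // [w z|w].
  rewrite -frob; congr f_; apply: val_inj.
  by rewrite val_meet /= -meetA [_ `&` U]meetC meetA.
have [z zw] := regular_mono_surj (restr U w) rs.
apply: le_anti; apply/andP; split; last by rewrite -adjq.
rewrite -[w `&` U]/(val (restr U w)) -zw /= -leD.
apply: (preserves_Sup_le (@inv_im_Sup _ _ _ _ f)); rewrite invol_le.
rewrite -le_subframeE adjq.
by rewrite -[w `&` U]/(val (restr U w)) -zw /=.
Qed.

Definition push s : rsided Q -> rsided Q := sval (cid (push_exists s)).

Lemma pushP s : bisection_push (bdom s) (pull s) (push s).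
Proof. exact: (svalP (cid (push_exists s))). Qed.

Lemma push_leE s w z : (push s w <= z) = (w `&` bdom s <= pull s (val z)^*).
Proof. by case: (pushP s). Qed.

Lemma push_frob s w z : push s (w `&` pull s (val z)^*) = push s w `&` z.
Proof. by case: (pushP s). Qed.

Lemma pushK s w : pull s (val (push s w))^* = w `&` bdom s.
Proof. by case: (pushP s). Qed.

(** The converse of [push_exists]: the conditions on [r o s] in the definition
    of a local bisection are equivalent to the equations for [q]. *)
Lemma bisection_intro U (p : Q -> rsided Q) q :
  preserves_Sup p -> {morph p : a b / a `&` b} -> p \top = U ->
  (forall z, p (val z) = z `&` U) -> bisection_push U p q ->
  exists2 s, bdom s = U & pull s =1 p.
Proof.
move=> pS pI pT pv [adj frob qK].
have pU a : sf_pred (principal_pred U) (p a).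
  by rewrite /= -pT; apply: (preserves_Sup_le pS); exact: lex1.
pose f a : downset U := Subframe (pU a).
have fS : preserves_Sup f.
  by move=> S; apply: val_inj; rewrite val_Sup image_comp /= pS.
have fI : {morph f : a b / a `&` b}.
  by move=> a b; apply: val_inj; rewrite val_meet /= pI.
have fT : f \top = \top by apply: val_inj; rewrite val_downset_top.
pose m := LocaleMap fS fI fT.
have dm : locale_comp (dom_map Q) m = incl_map U.
  by apply: locale_map_ext => z; apply: val_inj => /=; rewrite pv.
have valU (w : downset U) : val w `&` U = val w.
  by apply/meet_idPl; exact: (valP w).
have om : open_locale_map (locale_comp (cod_map Q) m).
  exists (fun u : downset U => q (val u)) => [u z|u z].
    by rewrite adj valU.
  by rewrite -frob val_meet.
have rm : regular_mono (locale_comp (cod_map Q) m).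
  apply: open_surj_regular_mono om _ => u; exists (q (val u)).
  by apply: val_inj => /=; rewrite qK valU.
by exists (Bisection dm om rm).
Qed.

Lemma push_mono s : {homo push s : w w' / w <= w'}.
Proof.
move=> w w' ww'; rewrite push_leE.
by apply: le_trans (_ : w' `&` _ <= _); [exact: leI2|rewrite -push_leE].
Qed.

Lemma push_Sup s : preserves_Sup (push s).
Proof.
move=> S; apply: eq_SupP => y; rewrite push_leE meetC meet_Sup.
split=> [/Sup_leP H _ [w Sw <-]|H].
  by rewrite push_leE meetC; apply: H; exists w.
by apply/Sup_leP => _ [w Sw <-]; rewrite meetC -push_leE; apply: H; exists w.
Qed.

Lemma push_pull s z : push s (pull s (val z)^*) = push s (bdom s) `&` z.
Proof. by rewrite -push_frob; congr push; rewrite meetC; apply/esym/meet_idPl/pull_le. Qed.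

Lemma push_meet_dom s w : push s (w `&` bdom s) = push s w.
Proof.
apply: le_anti; rewrite push_mono ?leIl //= push_leE pushK -meetA.
by rewrite meetxx.
Qed.

End BisectionData.

(** * Inverses *)

Section Inverse.
Variables (d : Order.disp_t) (Q : involutiveQuantalFrameType d).
Implicit Types (a b c x y : Q) (U w z : rsided Q) (s t e : bisection Q).

(** Since [push s] and [w |-> s^* w^*] are mutually inverse between the
    elements below the domain and those below the codomain, exchanging their
    roles yields the data of a bisection again; in particular [push s]
    preserves binary meets, which makes the section of the inverse a locale
    map. *)
Lemma inverse_exists s : exists2 s', bdom s' = push s (bdom s) &
  forall a, pull s' a = push s (pull s a^*).
Proof.
have pushI v w : push s (v `&` w) = push s v `&` push s w.
  by rewrite -push_frob pushK meetA push_meet_dom.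
pose p a := push s (pull s a^*); pose q w := pull s (val w)^*.
have pS : preserves_Sup p.
  by move=> S; rewrite /p invol_Sup pull_Sup push_Sup !image_comp.
have pI : {morph p : a b / a `&` b}.
  by move=> a b; rewrite /p invol_meet pullI pushI.
have pT : p \top = push s (bdom s) by rewrite /p invol_top pullT.
have pv z : p (val z) = z `&` push s (bdom s).
  by rewrite /p push_pull meetC.
have pqV z : p (val z)^* = push s z.
  by rewrite /p involK pull_val push_meet_dom.
have pq : bisection_push (push s (bdom s)) p q.
  split=> [w z|w z|w].
  - rewrite pqV /q; apply/idP/idP => [qz|wz].
      by rewrite meetC -push_pull push_mono.
    have: pull s (val (push s z))^* <= z by rewrite pushK leIl.
    apply: le_trans.
    rewrite -[leLHS](meet_idPl (pull_le _ _)) -pullT -pullI meetx1.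
    have -> : pull s (val w)^* = pull s (val (w `&` push s (bdom s)))^*.
      rewrite val_meet invol_meet pullI pushK meetxx.
      exact/esym/meet_idPl/pull_le.
    by apply: pull_mono; rewrite invol_le.
  - rewrite pqV /q val_meet invol_meet pullI pushK.
    by rewrite [z `&` _]meetC meetA (meet_idPl (pull_le _ _)).
  - by rewrite pqV /q push_pull meetC.
by have [s' <- s'p] := bisection_intro pS pI pT pv pq; exists s'.
Qed.

Definition inverse s : bisection Q := s2val (cid2 (inverse_exists s)).

Lemma bdom_inverse s : bdom (inverse s) = push s (bdom s).
Proof. exact: (s2valP (cid2 (inverse_exists s))). Qed.

Lemma pull_inverse s a : pull (inverse s) a = push s (pull s a^*).
Proof. exact: (s2valP' (cid2 (inverse_exists s))). Qed.

End Inverse.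

(** * Open quantal frames *)

Section OpenQuantalFrame.
Variables (d : Order.disp_t) (Q : involutiveQuantalFrameType d).
Implicit Types (a b c x y : Q) (z : rsided Q).
Hypothesis Qo : open_quantal_frame Q.

Lemma mul_meet b a c : b * ((a * \top) `&` c) = (b `&` (\top * a^*)) * c.
Proof. by case: Qo. Qed.

Lemma le_of_cube x a : x * x^* * x <= a -> x <= a.
Proof. by case: Qo => _ _ h _ xa; rewrite -[a]h; apply: le_Sup. Qed.

Lemma le_mul_top b : b <= b * \top.
Proof. by apply: le_of_cube; rewrite -mulgA; apply: mul_le2 => //; exact: lex1. Qed.

Lemma le_top_mul b : b <= \top * b.
Proof.
by rewrite -[leRHS]involK involM invol_top -[leLHS]involK invol_le le_mul_top.
Qed.

Lemma rsided_mul_le z a b : a <= val z -> a * b <= val z.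
Proof.
by move=> az; apply: le_trans (mul_le2 az (lex1 b)) _; exact: (valP z).
Qed.

Lemma lsided_mul_le z a b : b <= (val z)^* -> a * b <= (val z)^*.
Proof.
by rewrite -[b <= _]invol_le -[a * b <= _]invol_le involM involK; exact: rsided_mul_le.
Qed.

Fact right_ideal_subproof a : sf_pred (rsided_pred Q) (a * \top).
Proof. by rewrite /= -mulgA; apply: mul_le2 => //; exact: lex1. Qed.

(** For arrows, [a * \top] consists of the arrows with the same domain as some
    arrow in [a]. *)
Definition source a : rsided Q := Subframe (right_ideal_subproof a).

Lemma meet_rsided_invol x z : x `&` (val z)^* <= x * val z.
Proof.
have := mul_meet x (val z) \top.
rewrite open_rsidedE // meetx1 => ->.
apply: le_trans (le_mul_top _) _; apply: mul_le2 => //.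
by apply: leI2 => //; exact: le_top_mul.
Qed.

Lemma source_meet_le x y : val (source x^*) `&` y <= \top * (x * y).
Proof.
apply: le_trans (le_top_mul _) _; rewrite /= mul_meet meet1x involK.
by rewrite mulgA.
Qed.

Lemma le_source x : x <= (val (source x^*))^*.
Proof. by rewrite /= involM involK invol_top le_top_mul. Qed.

Lemma upsilon_ge x a : x * x^* <= a -> x <= upsilon a.
Proof. by move=> xa; apply: le_Sup; exists x, x; rewrite meetxx. Qed.

(** In the join defining [upsilon a] the pair [x, y] may be replaced by
    [x /\ y] twice. *)
Lemma upsilon_leP a b : (upsilon a <= b) <-> (forall x, x * x^* <= a -> x <= b).
Proof.
split=> [ab x xa|H]; first exact: le_trans (upsilon_ge xa) ab.
apply/Sup_leP => _ [x [y [xy ->]]]; apply: H.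
by apply: le_trans xy; apply: mul_le2; rewrite ?invol_le ?leIl ?leIr.
Qed.

Lemma upsilon_mono : {homo (@upsilon _ Q) : a b / a <= b}.
Proof.
by move=> a b ab; apply/upsilon_leP => x xa; apply/upsilon_ge/(le_trans xa).
Qed.

Lemma upsilonI : {morph (@upsilon _ Q) : a b / a `&` b}.
Proof.
move=> a b; apply: le_anti; rewrite lexI !upsilon_mono ?leIl ?leIr //=.
rewrite {1}/upsilon meetC meet_Sup; apply/Sup_leP => _ [_ [x [y [xy ->]]] <-].
rewrite meetC meet_Sup; apply/Sup_leP => _ [_ [p [q [pq ->]]] <-].
apply: upsilon_ge; rewrite lexI.
rewrite (le_trans _ xy) ?(le_trans _ pq) //; apply: mul_le2; rewrite ?invol_le.
- exact: le_trans (leIr _ _) (leIl _ _).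
- exact: le_trans (leIr _ _) (leIr _ _).
- exact: le_trans (leIl _ _) (leIl _ _).
- exact: le_trans (leIl _ _) (leIr _ _).
Qed.

Lemma upsilonT : upsilon (\top : Q) = \top.
Proof. by apply: le_anti; rewrite lex1 /=; apply: upsilon_ge; exact: lex1. Qed.

Lemma upsilon_val z : upsilon (val z) = val z.
Proof.
apply: le_anti; apply/andP; split.
  apply/upsilon_leP => x xz; apply: le_of_cube; exact: rsided_mul_le.
by apply: upsilon_ge; apply: rsided_mul_le.
Qed.

Lemma upsilon_invol a : upsilon a^* = upsilon a.
Proof.
suff H b : upsilon b <= upsilon b^*.
  by apply: le_anti; rewrite H andbT -[X in _ <= upsilon X]involK H.
apply/upsilon_leP => x xb; apply: upsilon_ge.
by rewrite -invol_le involK involM involK.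
Qed.

(** Read on a groupoid: the objects whose identity arrow lies in [a]. *)
Definition units a : rsided Q :=
  Subframe (P := rsided_pred Q) (let: And4 _ h _ _ := Qo in h a).

(** The left unit law.  If [p * q^* * y <= a] then the cube of [p /\ q /\ y] is
    below [a], so that meet is; conversely an [x] with cube below [a] is the
    meet of itself with [upsilon] of [x * x^*], by the pair [x * x^*, x]. *)
Lemma Sup_units_meet a :
  Sup [set u | exists x y, x * y <= a /\ u = upsilon x `&` y] = a.
Proof.
apply: le_anti; apply/andP; split.
  apply/Sup_leP => _ [x [y [xya ->]]].
  rewrite meetC /upsilon meet_Sup; apply/Sup_leP => _ [_ [p [q [pq ->]]] <-].
  apply: le_of_cube; apply: le_trans xya; apply: mul_le2; last exact: leIl.
  apply: le_trans pq; apply: mul_le2; rewrite ?invol_le.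
    exact: le_trans (leIr _ _) (leIl _ _).
  exact: le_trans (leIr _ _) (leIr _ _).
case: Qo => _ _ h _; rewrite -[leLHS]h; apply/Sup_leP => x xa.
apply: le_Sup; exists (x * x^*), x; split=> //.
by apply/esym/meet_idPr/upsilon_ge.
Qed.

End OpenQuantalFrame.

(** * Products, units and the natural order *)

Section Product.
Variables (d : Order.disp_t) (Q : involutiveQuantalFrameType d).
Implicit Types (a b c x y : Q) (U w z : rsided Q) (s t u e : bisection Q).
Hypotheses (Qo : open_quantal_frame Q) (Qw : weakly_multiplicative Q).

Let bact_Sup s : preserves_Sup (bact s).
Proof. by case: Qw. Qed.

(** The inverse image of the product [s t], written so that preservation of
    joins is inherited from the action of [s^-1]; [mul_pullE] is the usual
    formula. *)
Definition mul_pull s t a : rsided Q :=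
  pull s (val (pull t (bact (inverse s) a)))^*.

Lemma mul_pullE s t a : mul_pull s t a =
  Sup [set w | exists x y, x * y <= a /\ w = pull s (x `&` (val (pull t y))^*)].
Proof.
rewrite /mul_pull /bact pull_Sup val_Sup invol_Sup pull_Sup !image_comp.
have E x y : pull s (val (pull t (bpull (inverse s) x `&` y)))^* =
    pull s (x^* `&` (val (pull t y))^*).
  have -> : bpull (inverse s) x = val (push s (pull s x^*)).
    by rewrite -pull_inverse.
  rewrite pullI pull_val val_meet invol_meet pullI val_meet invol_meet pullI.
  rewrite pushK (meet_idPl (pull_le _ _)) -meetA -!pullI -invol_meet -val_meet.
  by rewrite [bdom t `&` _]meetC (meet_idPl (pull_le _ _)).
congr Sup; apply/seteqP; split=> [_ [_ [x [y [xy ->]]] <-]|_ [x [y [xy ->]]]].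
  by exists x^*, y; rewrite -E.
exists (bpull (inverse s) x^* `&` y); first by exists x^*, y; rewrite involK.
by rewrite /= E involK.
Qed.

Lemma mul_pull_leP s t a w : (mul_pull s t a <= w) <->
  forall x y, x * y <= a -> pull s (x `&` (val (pull t y))^*) <= w.
Proof.
rewrite mul_pullE Sup_leP; split=> [H x y xy|H _ [x [y [xy ->]]]]; last exact: H.
by apply: H; exists x, y.
Qed.

Lemma mul_pull_ge s t a x y :
  x * y <= a -> pull s (x `&` (val (pull t y))^*) <= mul_pull s t a.
Proof. by move: x y; apply/mul_pull_leP. Qed.

Lemma mul_pull_Sup s t : preserves_Sup (mul_pull s t).
Proof.
by move=> S; rewrite /mul_pull bact_Sup pull_Sup val_Sup invol_Sup pull_Sup !image_comp.
Qed.

Lemma mul_pullI s t : {morph mul_pull s t : a b / a `&` b}.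
Proof.
move=> a b; apply: le_anti; apply/andP; split.
  by rewrite lexI !(preserves_Sup_le (@mul_pull_Sup s t)) ?leIl ?leIr.
rewrite {1}mul_pullE meetC meet_Sup; apply/Sup_leP => _ [_ [x [y [xy ->]]] <-].
rewrite meetC {1}mul_pullE meet_Sup; apply/Sup_leP => _ [_ [x' [y' [xy' ->]]] <-].
rewrite -pullI meetACA -invol_meet -val_meet -pullI.
apply: mul_pull_ge; rewrite lexI.
by apply/andP; split; [apply: le_trans xy|apply: le_trans xy'];
  apply: mul_le2; rewrite ?leIl ?leIr.
Qed.

Lemma mul_pullT s t : mul_pull s t \top = pull s (val (bdom t))^*.
Proof.
apply: le_anti; apply/andP; split.
  apply/mul_pull_leP => x y _; apply: pull_mono.
  by apply: le_trans (leIr _ _) _; rewrite invol_le -le_subframeE pull_le.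
apply: le_trans (mul_pull_ge s t (lex1 (\top * \top : Q))).
by rewrite pullT meet1x.
Qed.

(** The domain of [s t] is that of [s]: where [s] is followed by an arrow
    landing in [pull t y], the arrow of [s] lies in [x * pull t y], which is
    below [x * y * \top]. *)
Lemma mul_pull_val s t z :
  mul_pull s t (val z) = z `&` pull s (val (bdom t))^*.
Proof.
apply: le_anti; apply/andP; split.
  rewrite lexI -mul_pullT (preserves_Sup_le (@mul_pull_Sup s t)) ?lex1 // andbT.
  apply/mul_pull_leP => x y xy; apply: (@le_trans _ _ (pull s (val z))); last first.
    by rewrite pull_val leIl.
  apply: pull_mono; apply: le_trans (meet_rsided_invol Qo _ _) _.
  have : pull t y <= source y.
    apply: le_trans (pull_mono t (le_mul_top Qo y)) _.
    by rewrite -[y * \top]/(val (source y)) pull_val leIl.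
  rewrite le_subframeE => /(mul_le2 (le_refl x)) /le_trans; apply.
  by rewrite /= mulgA; exact: rsided_mul_le.
apply: le_trans (mul_pull_ge s t (_ : val z * \top <= val z)); last exact: rsided_mul_le.
by rewrite pullT pullI pull_val -meetA leI2 // lexI pull_le lexx.
Qed.

(** The codomain map of [s t] is that of [s] followed by that of [t].  Only the
    part of [y] over the range of [x] contributes to the meet with [x], and
    that part is below [\top * (x * y)]. *)
Lemma mul_pull_invol s t z :
  mul_pull s t (val z)^* = pull s (val (pull t (val z)^*))^*.
Proof.
apply: le_anti; apply/andP; split; last first.
  apply: le_trans (mul_pull_ge s t (lsided_mul_le \top (le_refl (val z)^*))).
  by rewrite meet1x.
apply/mul_pull_leP => x y xy; apply: pull_mono.
apply: (@le_trans _ _ ((val (source x^*))^* `&` (val (pull t y))^*)).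
  by apply: leI2 => //; exact: le_source.
rewrite -invol_meet invol_le.
apply: (@le_trans _ _ (val (pull t (val (source x^*) `&` y)))).
  rewrite pullI pull_val 2!val_meet.
  have : val (pull t y) <= val (bdom t) by rewrite -le_subframeE pull_le.
  by move=> yt; rewrite !lexI leIl leIr (le_trans (leIr _ _) yt).
rewrite -le_subframeE; apply: pull_mono.
by apply: le_trans (source_meet_le Qo _ _) _; exact: lsided_mul_le.
Qed.

Lemma mul_exists s t : exists2 u, bdom u = pull s (val (bdom t))^* &
  pull u =1 mul_pull s t.
Proof.
apply: (@bisection_intro _ _ _ _
  (fun w => push t (push s (w `&` pull s (val (bdom t))^*)))).
- exact: mul_pull_Sup.
- exact: mul_pullI.
- exact: mul_pullT.
- by move=> z; rewrite mul_pull_val.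
set V := pull s _.
have VU : V <= bdom s by exact: pull_le.
split=> [w z|w z|w] /=.
- rewrite mul_pull_invol push_leE push_frob -meetA meetxx -push_frob -/V.
  by rewrite push_leE -meetA (meet_idPl VU).
- rewrite mul_pull_invol -[RHS]push_frob -[in RHS]push_frob; congr (push t (push s _)).
  by rewrite -!meetA [_ `&` V]meetC.
rewrite mul_pull_invol pushK push_frob -meetA meetxx -push_frob pushK -/V -meetA.
by rewrite (meet_idPl VU).
Qed.

Lemma bprod_pullE s t a : val (bprod_pull s t a) = mul_pull s t a.
Proof.
rewrite mul_pullE /bprod_pull val_Sup; congr Sup.
apply/seteqP; split=> [_ [_ [x [y [xy ->]]] <-]|_ [x [y [xy ->]]]].
  by exists x, y.
by exists (inv_im (bsec s) (x `&` (bpull t y)^*)) => //; exists x, y.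
Qed.

Lemma bmulP s t : is_bmul s t (s * t).
Proof.
have [u uU up] := mul_exists s t.
apply: (xgetPex s (P := [set u | is_bmul s t u])); exists u; split=> // a.
by rewrite bprod_pullE -up.
Qed.

Lemma bdom_mul s t : bdom (s * t) = pull s (val (bdom t))^*.
Proof. by case: (bmulP s t). Qed.

Lemma pull_mul s t a : pull (s * t) a = mul_pull s t a.
Proof. by case: (bmulP s t) => _ h; rewrite -bprod_pullE -h. Qed.

(** [upsilon] is a frame homomorphism with
    [upsilon z = upsilon z^* = z] on right-sided [z], hence a section of both
    structure maps. *)
Lemma unit_exists U : exists2 e, bdom e = U &
  forall a, pull e a = units Qo a `&` U.
Proof.
have uS : preserves_Sup (units Qo).
  by case: Qw => h _ _ S; apply: val_inj; rewrite val_Sup image_comp /= h.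
have uI : {morph units Qo : a b / a `&` b}.
  by move=> a b; apply: val_inj; rewrite val_meet /= upsilonI.
have uT : units Qo \top = \top.
  by apply: val_inj; rewrite val_rsidedT /= upsilonT.
have uv z : units Qo (val z) = z by apply: val_inj; exact: upsilon_val.
have uvi z : units Qo (val z)^* = z.
  by apply: val_inj; rewrite /= upsilon_invol; exact: upsilon_val.
apply: (@bisection_intro _ _ U (fun a => units Qo a `&` U) (fun w => w `&` U)).
- move=> S; rewrite uS meetC meet_Sup image_comp.
  by congr Sup; apply: eq_imagel => a _; rewrite /= meetC.
- by move=> a b; rewrite uI meetACA meetxx.
- by rewrite uT meet1x.
- by move=> z; rewrite uv.
- split=> [w z|w z|w]; rewrite uvi.
  + by rewrite [RHS]lexI leIr andbT.
  + by rewrite -!meetA meetxx [z `&` U]meetC.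
  + by rewrite -meetA meetxx.
Qed.

Definition unit_bisection U : bisection Q := s2val (cid2 (unit_exists U)).

Lemma bdom_unit U : bdom (unit_bisection U) = U.
Proof. exact: (s2valP (cid2 (unit_exists U))). Qed.

Lemma pull_unit U a : pull (unit_bisection U) a = units Qo a `&` U.
Proof. exact: (s2valP' (cid2 (unit_exists U))). Qed.

Lemma pull_unit_invol U z : pull (unit_bisection U) (val z)^* = z `&` U.
Proof.
by apply: val_inj; rewrite pull_unit !val_meet /= upsilon_invol // upsilon_val.
Qed.

Lemma bdom_unit_mul U t : bdom (unit_bisection U * t) = bdom t `&` U.
Proof. by rewrite bdom_mul pull_unit_invol. Qed.

Lemma pull_unit_mul U t a : pull (unit_bisection U * t) a = pull t a `&` U.
Proof.
rewrite pull_mul mul_pullE -{2}(Sup_units_meet Qo a) pull_Sup meetC meet_Sup.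
rewrite image_comp; congr Sup.
have E x y : pull (unit_bisection U) (x `&` (val (pull t y))^*) =
    U `&` pull t (upsilon x `&` y).
  rewrite pullI pull_unit pull_unit_invol pullI.
  rewrite -[upsilon x]/(val (units Qo x)) pull_val -[RHS]meetC.
  rewrite meetACA meetxx; congr (_ `&` _).
  by rewrite -meetA [bdom t `&` _]meetC (meet_idPl (pull_le _ _)).
apply/seteqP; split=> [_ [x [y [xy ->]]]|_ [_ [x [y [xy ->]]] <-]].
  by exists (upsilon x `&` y); [exists x, y|rewrite /= E].
by exists x, y; rewrite /= E.
Qed.

Lemma unit_mul_id t : unit_bisection (bdom t) * t = t.
Proof.
apply: bisection_ext => [|a]; first by rewrite bdom_unit_mul meetxx.
by rewrite pull_unit_mul; apply/meet_idPl/pull_le.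
Qed.

Lemma unit_idem U : bidempotent (unit_bisection U).
Proof. by rewrite /bidempotent -{1}(bdom_unit U) unit_mul_id. Qed.

(** For an idempotent, [z |-> e^* z^*] is idempotent, while it maps onto the
    elements below the domain; so it is the identity on these. *)
Lemma idempotent_invol e z : bidempotent e -> pull e (val z)^* = z `&` bdom e.
Proof.
move=> ee.
have eK w : pull e (val (pull e (val w)^*))^* = pull e (val w)^*.
  by rewrite -mul_pull_invol -pull_mul ee.
have fix_ w : w <= bdom e -> pull e (val w)^* = w.
  by move=> wU; rewrite -{1}(meet_idPl wU) -(pushK e w) eK pushK (meet_idPl wU).
rewrite -[RHS]fix_ ?leIr // val_meet invol_meet pullI (fix_ (bdom e)) //.
by apply/esym/meet_idPl/pull_le.
Qed.

Lemma upsilon_invol_Sup a :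
  (upsilon a)^* = Sup [set u | exists x y, x * y <= a /\ u = x^* `&` y].
Proof.
rewrite /upsilon invol_Sup; congr Sup; apply/seteqP; split.
  move=> _ [_ [x [y [xy ->]]] <-]; exists x, y^*.
  by rewrite invol_meet.
move=> _ [x [y [xy ->]]]; exists (x `&` y^*); last by rewrite invol_meet involK.
by exists x, y^*; rewrite involK.
Qed.

(** Since [e] acts as the identity on its domain, [e^-1 e] is computed by
    [e^*] applied to the join [(upsilon a)^*], so it is a unit.  Associativity
    then gives [e = (e^-1 e) e = e^-1 (e e) = e^-1 e]. *)
Lemma idempotent_unit e : bidempotent e -> e = unit_bisection (bdom e).
Proof.
move=> ee; have eE := idempotent_invol _ ee.
have pushE w : push e w = w `&` bdom e.
  apply: le_anti; apply/andP; split.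
    by rewrite push_leE eE -meetA meetxx.
  by rewrite -pushK eE leIl.
have pull_inv a : pull (inverse e) a = pull e a^*.
  by rewrite pull_inverse pushE; apply/meet_idPl/pull_le.
have unitE : unit_bisection (bdom e) = inverse e * e.
  apply: bisection_ext => [|a].
    by rewrite bdom_unit bdom_mul pull_inv involK pull_val meetxx.
  rewrite pull_unit pull_mul mul_pullE -eE /= upsilon_invol_Sup pull_Sup.
  have E x y : pull (inverse e) (x `&` (val (pull e y))^*) = pull e (x^* `&` y).
    rewrite pull_inv invol_meet involK !pullI pull_val.
    by congr (_ `&` _); apply/meet_idPl/pull_le.
  congr Sup; apply/seteqP; split=> [_ [_ [x [y [xy ->]]] <-]|_ [x [y [xy ->]]]].
    by exists x, y; rewrite E.
  by exists (x^* `&` y); [exists x, y|rewrite /= E].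
have assoc : inverse e * (e * e) = inverse e * e * e by case: Qw => _ _; apply.
have -> : unit_bisection (bdom e) = inverse e * e * e by rewrite -assoc ee.
by rewrite -unitE unit_mul_id.
Qed.

(** The natural order is restriction, as all idempotents are units and
    multiplying by a unit restricts. *)
Lemma bleP s t : ble s t <->
  bdom s <= bdom t /\ forall a, pull s a = pull t a `&` bdom s.
Proof.
split=> [[e /idempotent_unit-> ->]|[st sE]].
  rewrite bdom_unit_mul; split=> [|a]; first exact: leIl.
  rewrite pull_unit_mul meetA; congr (_ `&` _).
  by apply/esym/meet_idPl/pull_le.
exists (unit_bisection (bdom s)); first exact: unit_idem.
apply: bisection_ext => [|a]; first by rewrite bdom_unit_mul; apply/esym/meet_idPr.
by rewrite pull_unit_mul sE.
Qed.

(** The restriction of [t] to the join of the domains is already an upper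
    bound of [X]. *)
Lemma bdom_join X t : is_bjoin X t -> bdom t = Sup (@bdom _ Q @` X).
Proof.
move=> [ub lub]; set D := Sup _.
have DX s : X s -> bdom s <= D by move=> Xs; apply: le_Sup; exists s.
have Dt : D <= bdom t.
  by apply/Sup_leP => _ [s Xs <-]; have /bleP[] := ub s Xs.
have /bleP[tD _] : ble t (unit_bisection D * t).
  apply: lub => s Xs; have /bleP[st sE] := ub s Xs; apply/bleP.
  rewrite bdom_unit_mul lexI st DX //; split=> // a.
  rewrite pull_unit_mul sE -meetA; congr (_ `&` _).
  exact/esym/meet_idPr/DX.
by apply: le_anti; rewrite Dt andbT (le_trans tD) // bdom_unit_mul leIr.
Qed.

(** Taking [a] to be the top gives the sets that define [j]; the general form
    also bounds the completion elements generated by a single bisection. *)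
Lemma bclosed_pull_le a b : bclosed [set s | pull s a <= pull s b].
Proof.
split=> [s t /bleP[_ sE] /= tab|X t Xab _ tX] /=.
  by rewrite !sE leI2.
rewrite -(meet_idPl (pull_le t a)) (bdom_join tX) meet_Sup.
apply/Sup_leP => _ [_ [s Xs <-] <-]; have [ub _] := tX.
have /bleP[_ sE] := ub s Xs.
by rewrite -sE; apply: le_trans (Xab s Xs) _; rewrite sE leIl.
Qed.

End Product.

(** * The tensor with the completion *)

Section CompletionTensor.
Variables (d : Order.disp_t) (Q : involutiveQuantalFrameType d).
Implicit Types (a b c x y : Q) (U w z : rsided Q) (s t e : bisection Q).
Hypotheses (Qo : open_quantal_frame Q) (Qw : weakly_multiplicative Q).

Notation completion := (closed_sets (completion_system Q)).
Notation hull := (closed_hull (completion_system Q)).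
Notation pure := (pure_tensor (@completion_ract _ Q) (@lact _ Q)).

Lemma pure_le2 (A B : completion) x y :
  A <= B -> x <= y -> pure A x <= pure B y.
Proof.
move=> AB xy; have [l r _] := pure_balanced (@completion_ract _ Q) (@lact _ Q).
apply: le_trans (preserves_Sup_le (r A) xy) _.
exact: (preserves_Sup_le (l y) AB).
Qed.

Lemma mem_jmap s a : (val (jmap a) : set (bisection Q)) s <-> pull s a = bdom s.
Proof.
have E : [set s | bpull s a = val (bdom s)] = [set s | pull s \top <= pull s a].
  apply/seteqP; split=> t /=; rewrite pullT /bpull -/(pull t a).
    by move/val_inj ->.
  by move=> h; congr val; apply: le_anti; rewrite pull_le.
rewrite /jmap closed_hull_id; last by rewrite E; exact: bclosed_pull_le.
by split=> [/val_inj//|sa]; congr val.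
Qed.

(** A restriction [t] of [s] lying in [j a] has domain [t^*(a) <= t^*(b)], so
    it lies in [j b]. *)
Lemma hull_meet_jmap_le (X : set (bisection Q)) a b :
  (forall s, X s -> pull s a <= pull s b) ->
  hull X `&` jmap a <= jmap b.
Proof.
move=> Xab; apply/le_closed_setsP => s; rewrite val_closed_setsI => -[sX /mem_jmap sa].
have /(_ s sX) /= : val (hull X) `<=` [set s | pull s a <= pull s b].
  by move=> t tX; apply: tX; split; [exact: bclosed_pull_le|].
by rewrite sa => sb; apply/mem_jmap/le_anti; rewrite sb pull_le.
Qed.

(** Both inequalities move a right-sided element across the tensor: the
    codomain of [s] in one direction, the image under [s] of [s^*(x)] in the
    other. *)
Lemma j_tensor_id_right_adjoint a :
  j_tensor_id (right_adjoint (@mu0 _ Q) a) =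
  Sup [set u | exists s, u = pure (hull [set s]) (bact (inverse s) a)].
Proof.
have mulb := mu0_balanced Qo.
have mem_adj m n : (val (right_adjoint (@mu0 _ Q) a) : set (Q * Q)%type) (m, n)
    <-> m * n <= a.
  rewrite -pure_tensor_leP; split=> [h|mna].
    rewrite -[m * n](tensor_liftE mulb).
    apply: le_trans (preserves_Sup_le (tensor_lift_Sup mulb) h) _.
    rewrite /right_adjoint (tensor_lift_Sup mulb).
    by apply/Sup_leP => _ [t /= ta <-].
  by apply: le_Sup; rewrite /= /mu0 tensor_liftE.
have [pl pr pb] := pure_balanced (@completion_ract _ Q) (@lact _ Q).
apply: le_anti; apply/andP; split; apply/Sup_leP.
  move=> _ [[m n] /mem_adj mna <-] /=.
  (* Cover [j m] by the bisections it contains. *)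
  have -> : jmap m = Sup [set hull [set s] | s in [set s | pull s m = bdom s]].
    apply: eq_SupP => A; split=> [/le_closed_setsP jA _ [s sm <-]|H].
      by apply/closed_hull_leP => _ ->; apply/jA/mem_jmap.
    apply/le_closed_setsP => s /mem_jmap sm.
    have /closed_hull_leP : hull [set s] <= A by apply: H; exists s.
    exact.
  rewrite pl image_comp; apply/Sup_leP => _ [s sm <-] /=.
  apply: (@le_trans _ _ (pure (hull [set s]) (bact (inverse s) a))); last first.
    by apply: le_Sup; exists s.
  pose V := bdom (inverse s).
  have sV : hull [set s] = completion_ract (hull [set s]) V.
    rewrite /completion_ract; apply/esym/meet_idPl/closed_hull_leP => _ ->.
    by apply/mem_jmap; rewrite /V bdom_inverse pushK meetxx.
  rewrite {1}sV pb; apply: pure_le2 => //.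
  apply: le_Sup; exists m^*, n; rewrite involK; split=> //.
  have -> : bpull (inverse s) m^* = val (pull (inverse s) m^*) by [].
  by rewrite pull_inverse involK sm /lact meetC /V bdom_inverse.
move=> _ [s ->]; rewrite /bact pr; apply/Sup_leP => _ [_ [x [y [xy ->]]] <-].
have -> : bpull (inverse s) x = val (push s (pull s x^*)).
  by rewrite -pull_inverse.
rewrite meetC -/(lact _ y) -pb.
apply: (@le_trans _ _ (pure (jmap x^*) y)).
  apply: pure_le2 => //; apply: hull_meet_jmap_le => _ ->.
  by rewrite pushK leIl.
by apply: le_Sup; exists (x^*, y) => //; exact/mem_adj.
Qed.

End CompletionTensor.

Theorem theorem5p24 (d : Order.disp_t) (Q : involutiveQuantalFrameType d) :
  open_quantal_frame Q -> weakly_multiplicative Q -> embeddable Q ->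
  multiplicative Q.
Proof.
move=> Qo Qw [_ /monomorphism_inj j_inj] S; apply: j_inj.
have j_mono : {homo @j_tensor_id _ Q : t u / t <= u}.
  move=> t u /le_closed_setsP tu; apply/Sup_leP => _ [p tp <-].
  by apply: le_Sup; exists p => //; exact: tu.
have adj_mono : {homo right_adjoint (@mu0 _ Q) : a b / a <= b}.
  move=> a b ab; apply/Sup_leP => t /= ta; apply: le_Sup; exact: le_trans ab.
apply: le_anti; apply/andP; split; last first.
  by apply/j_mono/Sup_leP => _ [a Sa <-]; apply: adj_mono; exact: le_Sup.
rewrite j_tensor_id_right_adjoint //; apply/Sup_leP => _ [s ->].
have bactS : preserves_Sup (bact (inverse s)) by case: Qw.
have [_ pr _] := pure_balanced (@completion_ract _ Q) (@lact _ Q).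
rewrite bactS pr; apply/Sup_leP => _ [_ [a Sa <-] <-].
apply: (@le_trans _ _ (j_tensor_id (right_adjoint (@mu0 _ Q) a))).
  by rewrite j_tensor_id_right_adjoint //; apply: le_Sup; exists s.
by apply/j_mono/le_Sup; exists a.
Qed.
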